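(* Let $\mathrm{S}=(P,T,F,M_0)$ be a place/transition net. If $\mathrm{S}$ is e/l-persistent, then there exists $\mathrm{k}\in\mathbb{N}$ such that $\mathrm{S}$ is e/l-$\mathrm{k}$-persistent.
   Context: A place/transition net (p/t-net) is $\mathrm{S}=(P,T,F,M_0)$ where $P$ (places) and $T$ (transitions) are finite disjoint sets, $F\subseteq P\times T\cup T\times P$ is the flow relation, and $M_0\in\mathbb{N}^P$ is the initial marking. Markings are vectors in $\mathbb{N}^P$, ordered and added componentwise. For $a\in T$, ${}^\bullet a\in\mathbb{N}^P$ is the vector with $1$ at places $p$ with $(p,a)\in F$ and $0$ elsewhere; $a^\bullet$ is the vector with $1$ at places $p$ with $(a,p)\in F$ and $0$ elsewhere. A transition $a$ is enabled in $M$ (written $Ma$) iff ${}^\bullet a\le M$; then firing $a$ yields $M'=(M-{}^\bullet a)+a^\bullet$ (written $MaM'$). This is extended to strings $w\in T^*$: $M\varepsilon M$, and $MvaM''$ iff $MvM'$ and $M'aM''$ for some $M'$; $Mw$ means $MwM'$ for some $M'$. The set $[M_0\rangle$ of reachable markings consists of all $M'$ with $M_0wM'$ for some $w\in T^*$. The net is e/l-persistent iff for all $M\in[M_0\rangle$ and all $a,b\in T$ with $a\ne b$: $Ma\wedge Mb\Rightarrow \exists v\in T^*\ Mavb$. For $\mathrm{k}\in\mathbb{N}$, a step $Ma$ (with $a$ enabled in $M$) is e/l-$\mathrm{k}$-persistent iff for every $b\in T$, $b\neq a$, $Mb$ implies that there exists $w\in T^*$ with $|w|\le\mathrm{k}$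 and $Mawb$. A marking $M$ is e/l-$\mathrm{k}$-persistent iff for every $a\in T$ enabled in $M$ the step $Ma$ is e/l-$\mathrm{k}$-persistent; the net is e/l-$\mathrm{k}$-persistent iff every marking in $[M_0\rangle$ is e/l-$\mathrm{k}$-persistent. *)

(* Defs.v *)
From mathcomp Require Import all_boot.

Set Implicit Arguments.
Unset Strict Implicit.
Unset Printing Implicit Defensive.

(* Places and transitions are separate types, which renders their disjointness;
   accordingly the flow relation, a subset of P x T \cup T x P, is a set of
   elements of the disjoint sum of the two products. *)
Record ptnet := PTNet {
  place : finType;
  transition : finType;
  flow : {set (place * transition) + (transition * place)};
  init : {ffun place -> nat}
}.

Definition marking (N : ptnet) : Type := {ffun place N -> nat}.

Section Firing.

Variable N : ptnet.
Implicit Types (M : marking N) (a b : transition N) (w : seq (transition N)).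

Definition lem M M' : bool := [forall p, M p <= M' p].

Definition pre a : marking N := [ffun p => nat_of_bool (inl (p, a) \in flow N)].

Definition post a : marking N := [ffun p => nat_of_bool (inr (a, p) \in flow N)].

Definition enabled M a : bool := lem (pre a) M.

(* The truncated subtraction is exact, since [pre a] is below [M] whenever [a]
   may fire. *)
Definition fires M a M' : Prop :=
  enabled M a /\ M' = [ffun p => (M p - pre a p) + post a p].

Inductive fires_seq M : seq (transition N) -> marking N -> Prop :=
| fires_nil : fires_seq M [::] M
| fires_rcons w a M' M'' :
    fires_seq M w M' -> fires M' a M'' -> fires_seq M (rcons w a) M''.

Definition enabled_seq M w : Prop := exists M', fires_seq M w M'.

Definition reachable M : Prop := exists w, fires_seq (init N) w M.

Definition el_persistent : Prop :=
  forall M, reachable M -> forall a b, a != b ->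
    enabled M a -> enabled M b -> exists v, enabled_seq M (a :: rcons v b).

Definition el_k_persistent_step (k : nat) M a : Prop :=
  forall b, b != a -> enabled M b ->
    exists w, size w <= k /\ enabled_seq M (a :: rcons w b).

Definition el_k_persistent_marking (k : nat) M : Prop :=
  forall a, enabled M a -> el_k_persistent_step k M a.

Definition el_k_persistent (k : nat) : Prop :=
  forall M, reachable M -> el_k_persistent_marking k M.

End Firing.

Arguments el_persistent : clear implicits.
Arguments el_k_persistent : clear implicits.

(* Main.v *)
Require Import Defs.
From mathcomp Require Import all_boot.
From Stdlib Require Import Classical.

(** Firing is monotone: a word enabled in [M] is enabled in every larger marking.
    So for fixed transitions [a] and [b] the markings enabling [a v b] for some
    [v] form an upward closed set, which by Dickson's lemma is generated by
    finitely many markings. Choosing one [v] for each generator bounds the length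
    of the [v] needed, uniformly in the marking. *)

(* Dickson's lemma with the finite basis replaced by a bound [k] on a rank:
   the elements of rank at most [k] need not be finitely many, but every ranked
   element lies above one of them. In the induction the rank is made to bound the
   new coordinate [p] as well: an [f] with [f p] at least the bound [k] of the
   other coordinates is then covered, and [f p] takes finitely many values
   otherwise. *)
Lemma dickson_rank_seq (T : finType) (s : seq T)
    (Q : {ffun T -> nat} -> nat -> Prop) :
  (forall f m n, m <= n -> Q f m -> Q f n) ->
  exists k, forall f n, Q f n ->
    exists2 g, Q g k & {in s, forall p, g p <= f p}.
Proof.
elim: s Q => [|p s IHs] Q Qmono.
  have [[f [n Qfn]]|noQ] := classic (exists f n, Q f n).
    by exists n => *; exists f.
  by exists 0 => f n Qfn; case: noQ; exists f, n.
have [|k0 Hk0] := IHs (fun f n => Q f n /\ f p <= n).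
  by move=> f m n mn [Qfm fpm]; split; [apply: Qmono Qfm | apply: leq_trans mn].
have /fin_all_exists[k Hk] (i : 'I_k0) : exists k, forall f n,
    Q f n /\ f p = i ->
    exists2 g, Q g k /\ g p = i & {in s, forall q, g q <= f q}.
  by apply: IHs => f m n mn [Qfm fpi]; split=> //; apply: Qmono Qfm.
exists (maxn k0 (\max_i k i)) => f n Qfn.
have [k0f|fk0] := leqP k0 (f p).
  (* Raising the rank to [maxn n (f p)] makes it bound [f p] too; then [g p <= k0 <= f p]. *)
  have [|g [Qg gp] gf] := Hk0 f (maxn n (f p)).
    by split; [apply: Qmono Qfn; apply: leq_maxl | apply: leq_maxr].
  exists g; first by apply: Qmono Qg; apply: leq_maxl.
  by move=> q /[!inE] /predU1P[->|/gf//]; apply: leq_trans k0f.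
have [|g [Qg gp] gf] := Hk (Ordinal fk0) f n; first by [].
exists g; first by apply: Qmono Qg; rewrite leq_max leq_bigmax orbT.
by move=> q /[!inE] /predU1P[->|/gf//]; rewrite gp.
Qed.

Section Monotonicity.

Variable N : ptnet.
Implicit Types (M K : marking N) (a : transition N) (w : seq (transition N)).

Lemma fires_mono M K a M' :
  lem M K -> fires M a M' -> exists2 K', fires K a K' & lem M' K'.
Proof.
move=> /forallP MK [/forallP Ma ->].
exists [ffun p => (K p - pre a p) + post a p].
  by split=> //; apply/forallP => p; apply: leq_trans (Ma p) (MK p).
by apply/forallP => p; rewrite !ffunE leq_add2r leq_sub2r.
Qed.

Lemma fires_seq_mono M K w M' :
  lem M K -> fires_seq M w M' -> exists2 K', fires_seq K w K' & lem M' K'.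
Proof.
move=> MK; elim=> [|v a M1 M2 _ [K1 Kv MK1] M1a].
  by exists K => //; constructor.
have [K2 K1a MK2] := fires_mono _ _ _ _ MK1 M1a.
by exists K2 => //; apply: fires_rcons Kv K1a.
Qed.

Lemma enabled_seq_mono M K w : lem M K -> enabled_seq M w -> enabled_seq K w.
Proof. by move=> MK [M' /(fires_seq_mono _ _ _ _ MK)[K' Kw _]]; exists K'. Qed.

(** With the bound on the length of [w] as rank, Dickson's lemma yields some [K] below [M] with
    [size w <= k]; monotonicity carries the word from [K] to [M]. *)
Lemma enabled_seq_bounded (a b : transition N) :
  exists k, forall M v, enabled_seq M (a :: rcons v b) ->
    exists w, size w <= k /\ enabled_seq M (a :: rcons w b).
Proof.
have [|k Hk] := dickson_rank_seq _ (enum (place N)) (fun M n =>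
  exists w, size w <= n /\ enabled_seq (M : marking N) (a :: rcons w b)).
  by move=> M m n mn [w [wm Mw]]; exists w; split=> //; apply: leq_trans mn.
exists k => M v Mv; have [|K [w [wk Kw]] KM] := Hk M (size v); first by exists v.
exists w; split=> //; apply: enabled_seq_mono Kw.
by apply/forallP => p; apply: KM; rewrite mem_enum.
Qed.

End Monotonicity.

Theorem theorem10 (N : ptnet) :
  el_persistent N -> exists k : nat, el_k_persistent N k.
Proof.
move=> persN.
have /fin_all_exists[k Hk] (ab : transition N * transition N) :=
  enabled_seq_bounded N ab.1 ab.2.
(* There are finitely many pairs of transitions, so one maximum serves all. *)
exists (\max_ab k ab) => M reachM a Ma b ba Mb.
have [|v Mv] := persN M reachM a b _ Ma Mb; first by rewrite eq_sym.
have [w [wk Mw]] := Hk (a, b) M v Mv.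
by exists w; split=> //; apply: leq_trans wk (leq_bigmax _).
Qed.
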